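(* Let $D\subset\mathbb{C}^n$ be B-regular and let $A\subset\partial D$ be a b-pluripolar set. Then $$\hat A=A\cup\{z\in D:\ \omega(z,A,D)<0\}.$$
   Context: $\mathrm{PSH}(D)$ denotes the family of all plurisubharmonic functions on $D$. For $u:D\to\mathbb{R}\cup\{-\infty\}$ and $x\in\overline D$, $u^*(x)=\limsup_{z\to x,\,z\in D}u(z)=\lim_{r\to0}\sup_{B(x,r)\cap D}u$. A bounded domain $D\subset\mathbb{C}^n$ is B-regular if every $f\in C(\partial D)$ can be extended to a plurisubharmonic function on $D$ that is continuous on $\overline D$. For $A\subset\partial D$ and $z\in D$, $\omega(z,A,D)=\sup\{u(z):u\in\mathrm{PSH}(D),\ u\le0,\ u^*\le-1\text{ on }A\}$. A set $A\subset\partial D$ is b-pluripolar if there exists $u\in\mathrm{PSH}(D)$, $u\le0$, $u\not\equiv-\infty$, such that $u^*=-\infty$ on $A$. The b-pluripolar hull of a b-pluripolar set $A\subset\partial D$ is $$\hat A=\{z\in\overline D:\ u^*(z)=-\infty\text{ for all }u\in\mathrm{PSH}(D)\text{ with }u\not\equiv-\infty,\ u<0,\ u^*|_A=-\infty\}.$$ *)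

(* Defs.v *)
From HB Require Import structures.
From mathcomp Require Import all_boot all_order all_algebra.
From mathcomp Require Import complex.
From mathcomp Require Import all_classical all_reals all_analysis.

Set Implicit Arguments.
Unset Strict Implicit.
Unset Printing Implicit Defensive.

Import Order.TTheory GRing.Theory Num.Theory.
Import numFieldNormedType.Exports.

Local Open Scope classical_set_scope.
Local Open Scope ring_scope.
Local Open Scope complex_scope.

(* R[i] carries no topology in the libraries: give it the one that every
   numFieldType T has through T^o, namely the one of the complex modulus. *)
#[export, non_forgetful_inheritance]
HB.instance Definition _ (R : realType) :=
  PseudoPointedMetric.copy R[i] (R[i])^o.
#[export, non_forgetful_inheritance]
HB.instance Definition _ (R : realType) := GRing.ComAlgebra.copy R[i] (R[i])^o.
#[export, non_forgetful_inheritance]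
HB.instance Definition _ (R : realType) := NormedModule.copy R[i] (R[i])^o.

Definition boundary (T : topologicalType) (D : set T) : set T :=
  closure D `\` interior D.

(* Functions defined on a set D are represented by total functions whose values
   outside D are irrelevant: every notion below only depends on u restricted
   to D. *)

Definition usc_on (R : realType) (T : topologicalType) (D : set T)
    (u : T -> \bar R) : Prop :=
  forall x, D x -> forall a : R, (u x < a%:E)%E ->
    \forall y \near within D (nbhs x), (u y < a%:E)%E.

(* The function identically -oo is allowed.  The integral makes sense because an
   upper semicontinuous v < +oo is bounded above on circles; its value may
   be -oo. *)
Definition subharmonic (R : realType) (V : set R[i]) (v : R[i] -> \bar R)
    : Prop :=
  [/\ forall z, V z -> (v z < +oo)%E,
      usc_on V v &
      forall (c : R[i]) (r : R), 0 < r ->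
        [set z : R[i] | `|z - c| <= r%:C] `<=` V ->
        (v c <= ((2 * pi)^-1)%R%:E *
           \int[lebesgue_measure]_(t in `[0%R, (2 * pi)%R])
             v (c + r%:C * (cos t +i* sin t))%R)%E].

Definition psh (R : realType) (n : nat) (D : set 'rV[R[i]]_n)
    (u : 'rV[R[i]]_n -> \bar R) : Prop :=
  [/\ forall z, D z -> (u z < +oo)%E,
      usc_on D u &
      forall a b : 'rV[R[i]]_n,
        subharmonic [set l : R[i] | D (a + l *: b)]
                    (fun l : R[i] => u (a + l *: b))].

(* The limsup is not punctured: for x in D the value u x is taken into account,
   as in lim_(r -> 0) sup_(B(x, r) `&` D) u. *)
Definition ustar (R : realType) (n : nat) (D : set 'rV[R[i]]_n)
    (u : 'rV[R[i]]_n -> \bar R) (x : 'rV[R[i]]_n) : \bar R :=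
  limf_esup u (within D (nbhs x)).

Definition bounded_domain (R : realType) (n : nat) (D : set 'rV[R[i]]_n)
    : Prop :=
  [/\ open D, connected D, D !=set0 & bounded_set D].

Definition B_regular (R : realType) (n : nat) (D : set 'rV[R[i]]_n) : Prop :=
  bounded_domain D /\
  forall f : 'rV[R[i]]_n -> R, {within boundary D, continuous f} ->
    exists F : 'rV[R[i]]_n -> R,
      [/\ {within closure D, continuous F},
          forall x, boundary D x -> F x = f x &
          psh D (fun z => (F z)%:E)].

Definition omega (R : realType) (n : nat) (z : 'rV[R[i]]_n)
    (A D : set 'rV[R[i]]_n) : \bar R :=
  ereal_sup [set u z | u in [set u : 'rV[R[i]]_n -> \bar R |
    [/\ psh D u, forall w, D w -> (u w <= 0)%E &
        forall x, A x -> (ustar D u x <= (-1)%:E)%E]]].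

Definition not_identically_ninfty (R : realType) (n : nat)
    (D : set 'rV[R[i]]_n) (u : 'rV[R[i]]_n -> \bar R) : Prop :=
  exists2 z, D z & u z != -oo%E.

Definition b_pluripolar (R : realType) (n : nat) (D A : set 'rV[R[i]]_n)
    : Prop :=
  A `<=` boundary D /\
  exists u : 'rV[R[i]]_n -> \bar R,
    [/\ psh D u, forall z, D z -> (u z <= 0)%E, not_identically_ninfty D u &
        forall x, A x -> ustar D u x = -oo%E].

Definition b_pluripolar_hull (R : realType) (n : nat)
    (D A : set 'rV[R[i]]_n) : set 'rV[R[i]]_n :=
  [set z | closure D z /\
    forall u : 'rV[R[i]]_n -> \bar R,
      psh D u -> not_identically_ninfty D u ->
      (forall w, D w -> (u w < 0)%E) ->
      (forall x, A x -> ustar D u x = -oo%E) ->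
      ustar D u z = -oo%E].

(* Main.v *)
Require Import Defs.
From mathcomp Require Import all_boot all_order all_algebra.
From mathcomp Require Import complex ring lra.
From mathcomp Require Import all_classical all_reals all_analysis.
From mathcomp Require Import measurable_realfun.

Set Implicit Arguments.
Unset Strict Implicit.
Unset Printing Implicit Defensive.

Import Order.TTheory GRing.Theory Num.Theory.
Import numFieldNormedType.Exports.
Local Open Scope classical_set_scope.
Local Open Scope ring_scope.
Local Open Scope complex_scope.

(** Write u^* for [ustar D u].  The link between the extremal function and
    hulls is a convergence argument.  A function u as in the definition of the
    hull can be scaled: eps u competes in [omega z A D] for every eps > 0, so
    if u z is finite then omega z A D >= 0 ([omega_lt0_hull]).  Conversely, if
    countably many nonpositive plurisubharmonic functions u_j satisfy
    u_j^* <= -1 at each point of A for all large j, then their sum is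
    plurisubharmonic with upper regularization -oo on A, and it is finite
    wherever u_j >= - 2^-(j+2) for all j ([psh_pluripolar_witness]).  If z in D
    has omega z A D >= 0, near-optimal competitors u_j at z give such a sum
    that is finite at z, so z is not in the hull ([hull_omega_lt0]).

    The remaining point is that the hull meets the boundary only in A
    ([hull_boundary]), and this is where B-regularity is used.  Fix z in the
    boundary but not in A, and let F be the plurisubharmonic extension of
    x |-> - |x - z|; by the maximum principle F <= 0 on D ([peak_function],
    [maximum_principle]).  Let v be the function that witnesses that A is
    b-pluripolar.  Then u_j = max (s_j v, (j + 1) F) satisfies u_j^* <= -1 at
    each x in A as soon as (j + 1) |x - z| > 2, whatever the scalars s_j > 0.
    Since v is finite on a dense subset of D ([psh_finite_dense]), there is a
    sequence w_m -> z of points where v is finite and along which F tends to 0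
    very fast.  For j <= m the bound on F alone gives
    u_j (w_m) >= - 2^-(j+2), and for j > m, only finitely many m for each j,
    it is enforced by taking s_j small ([uniform_scaling]).  The sum u of the
    u_j then satisfies u (w_m) >= -1 for every m, whence u^* z >= -1, and z is
    not in the hull.

    Everything else is the elementary theory of plurisubharmonic functions:
    stability under maxima, scaling and series of nonpositive functions, and a
    quantitative mean value inequality on circles ([psh_submean_near]) from
    which both the maximum principle and the density of {v > -oo} follow. *)

(** * The norm as a real number *)

(** The norm of a normed module over R[i] takes values in R[i]; its real part
    carries the same information and can be used in real inequalities. *)
Definition rnorm {R : realType} {V : normedModType R[i]} (x : V) : R :=
  complex.Re `|x|.

Section RealNorm.
Context {R : realType} {V : normedModType R[i]}.
Implicit Types (x y : V).

Lemma rnormE x : `|x| = (rnorm x)%:C.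
Proof. by rewrite RRe_real // ger0_real. Qed.

Lemma rnorm_ge0 x : 0 <= rnorm x.
Proof. by rewrite -lecR -rnormE normr_ge0. Qed.

Lemma rnorm0 : rnorm (0 : V) = 0.
Proof. by rewrite /rnorm normr0. Qed.

Lemma rnorm_gt0 x : (0 < rnorm x) = (x != 0).
Proof. by rewrite -ltcR -rnormE normr_gt0. Qed.

Lemma rnormZ (l : R[i]) x : rnorm (l *: x) = complex.Re `|l| * rnorm x.
Proof.
have l_real : `|l| = (complex.Re `|l|)%:C by rewrite RRe_real // ger0_real.
by rewrite /rnorm normrZ [X in X * _]l_real [X in _ * X]rnormE -rmorphM.
Qed.

Lemma rnormD x y : rnorm (x + y) <= rnorm x + rnorm y.
Proof. by rewrite -lecR rmorphD /= -!rnormE ler_normD. Qed.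

Lemma rnormN x : rnorm (- x) = rnorm x.
Proof. by rewrite /rnorm normrN. Qed.

Lemma rdistC x y : rnorm (x - y) = rnorm (y - x).
Proof. by rewrite -rnormN opprB. Qed.

Lemma rdistD x y z : rnorm (x - z) <= rnorm (x - y) + rnorm (y - z).
Proof. by apply: le_trans (rnormD _ _); rewrite addrA subrK. Qed.

End RealNorm.

Lemma nbhs_rnorm {R : realType} {n : nat} (x : 'rV[R[i]]_n)
    (U : set 'rV[R[i]]_n) :
  nbhs x U <-> exists2 e : R, 0 < e & forall y, rnorm (x - y) < e -> U y.
Proof.
split.
  move=> /(@nbhs_normP R[i] 'rV[R[i]]_n)[e /= e0 eU].
  have e_real : (complex.Re e)%:C = e by rewrite RRe_real // realE ltW.
  exists (complex.Re e); first by rewrite -ltcR e_real.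
  move=> y xy; apply: eU; rewrite /= -e_real.
  by rewrite rnormE ltcR.
move=> [e e0 eU]; apply/(@nbhs_normP R[i] 'rV[R[i]]_n).
exists e%:C; first by rewrite /= ltcR.
by move=> y /=; rewrite rnormE ltcR; exact: eU.
Qed.

Lemma nbhs_complex {R : realType} (x : R[i]) (U : set R[i]) :
  nbhs x U <->
  exists2 e : R, 0 < e & forall y, complex.Re `|x - y| < e -> U y.
Proof.
have norm_real z : `|z| = (complex.Re `|z|)%:C :> R[i].
  by rewrite RRe_real // ger0_real.
split.
  move=> /(@nbhs_normP R[i] R[i])[e /= e0 eU].
  have e_real : (complex.Re e)%:C = e by rewrite RRe_real // realE ltW.
  exists (complex.Re e); first by rewrite -ltcR e_real.
  by move=> y xy; apply: eU; rewrite /= -e_real norm_real ltcR.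
move=> [e e0 eU]; apply/(@nbhs_normP R[i] R[i]).
exists e%:C; first by rewrite /= ltcR.
by move=> y /=; rewrite norm_real ltcR; exact: eU.
Qed.

Lemma line_continuous {R : realType} {n : nat} (a b : 'rV[R[i]]_n) :
  continuous (fun l : R[i] => a + l *: b).
Proof.
move=> l U /nbhs_rnorm [e e0 eU]; apply/nbhs_complex.
have b0 : 0 < rnorm b + 1 by rewrite ltr_wpDl // rnorm_ge0.
exists (e / (rnorm b + 1)); first by rewrite divr_gt0.
move=> y ly; apply: eU.
rewrite opprD addrACA subrr add0r -scalerBl rnormZ.
apply: le_lt_trans (_ : complex.Re `|l - y| * (rnorm b + 1) < e).
  by rewrite ler_wpM2l ?lerDl // -lecR RRe_real ?ger0_real ?normr_ge0.
by rewrite -ltr_pdivlMr.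
Qed.

(** * Circles and upper semicontinuity *)

Definition circle {R : realType} (c : R[i]) (r t : R) : R[i] :=
  c + r%:C * (cos t +i* sin t).

Definition circle_mean {R : realType} (v : R[i] -> \bar R) (c : R[i]) (r : R) :=
  (((2 * pi)^-1)%R%:E *
     \int[lebesgue_measure]_(t in `[0%R, (2 * pi)%R]) v (circle c r t))%E.

Lemma real_complex_continuous (R : realType) :
  continuous (fun x : R => x%:C : R[i]).
Proof.
move=> x; apply/cvgrPdist_lt => e e0.
have e_real : (complex.Re e)%:C = e.
  by rewrite RRe_real // realE ltW.
have e0' : 0 < complex.Re e by rewrite -ltcR e_real.
near=> y.
rewrite -rmorphB /= normc_def /= expr0n addr0 sqrtr_sqr -e_real ltcR.
near: y; move: e0'; generalize (complex.Re e).
by apply/cvgrPdist_lt.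
Unshelve. all: by end_near. Qed.

Lemma circle_continuous (R : realType) (c : R[i]) (r : R) :
  continuous (circle c r).
Proof.
have -> : circle c r =
    fun t => c + r%:C * ((cos t)%:C + 'i%C * (sin t)%:C).
  by apply/funext => t; rewrite /circle [cos t +i* sin t]complexE.
move=> t; apply: cvgD; first exact: cvg_cst.
apply: cvgM; first exact: cvg_cst.
apply: cvgD.
  exact: (cvg_comp _ _ (@continuous_cos R t) (@real_complex_continuous R _)).
apply: cvgM; first exact: cvg_cst.
exact: (cvg_comp _ _ (@continuous_sin R t) (@real_complex_continuous R _)).
Qed.

Lemma circle_dist (R : realType) (c : R[i]) (r t : R) :
  0 <= r -> `|circle c r t - c| = r%:C.
Proof.
move=> r0; rewrite /circle addrC addKr normrM !normc_def /=.
by rewrite expr0n addr0 sqrtr_sqr cos2Dsin2 sqrtr1 mulr1 ger0_norm.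
Qed.

Lemma usc_on_comp (R : realType) (S T : topologicalType) (D : set T)
    (u : T -> \bar R) (g : S -> T) :
  continuous g -> usc_on D u -> usc_on (g @^-1` D) (u \o g).
Proof.
move=> cg uscu s Dgs a ua; rewrite !near_withinE.
have := uscu _ Dgs a ua; rewrite near_withinE => h.
exact: (cg s _ h).
Qed.

(** The sets {u < a} are relatively open in D, and the rays ]-oo, a[ generate
    the Borel sets of the extended line. *)
Lemma usc_on_measurable (R : realType) (D : set R) (u : R -> \bar R) :
  measurable D -> usc_on D u -> measurable_fun D u.
Proof.
move=> mD uscu; apply: (measurability _ (ErealGenInftyO.measurableE R)).
move=> /= _ [_ [a ->]] <-.
have -> : D `&` u @^-1` `]-oo, a%:E[ = D `&` ([set x | D x -> u x < a%:E]°)%E.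
  apply/seteqP; split => x [Dx].
    rewrite /= in_itv /= => ua; split => //.
    by have := uscu x Dx a ua; rewrite near_withinE.
  by move=> /interior_subset /(_ Dx) ua; split=> //=; rewrite in_itv.
apply: measurableI => //; apply: open_measurable; exact: open_interior.
Qed.

(** Both integrals may be infinite: the inequality holds because the positive
    and negative parts are compared separately and extended subtraction is
    monotone. *)
Lemma le_integral_measurable d (T : measurableType d) (R : realType)
    (mu : {measure set T -> \bar R}) (D : set T) (f g : T -> \bar R) :
  measurable D -> measurable_fun D f -> measurable_fun D g ->
  (forall x, D x -> (f x <= g x)%E) ->
  (\int[mu]_(x in D) f x <= \int[mu]_(x in D) g x)%E.
Proof.
move=> mD mf mg fg; rewrite [leLHS]integralE [leRHS]integralE; apply: leeB.
  apply: ge0_le_integral => //; try exact: measurable_funepos.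
  move=> x Dx; apply: (@funepos_le _ _ D) => //; last exact/mem_set.
  by move=> y /set_mem; exact: fg.
apply: ge0_le_integral => //; try exact: measurable_funeneg.
move=> x Dx; apply: (@funeneg_le _ _ D) => //; last exact/mem_set.
by move=> y /set_mem; exact: fg.
Qed.

(** * Operations on plurisubharmonic functions *)

Section Plurisubharmonic.
Context {R : realType} {n : nat}.
Implicit Types (D : set 'rV[R[i]]_n) (u v : 'rV[R[i]]_n -> \bar R).
Implicit Types (a b : 'rV[R[i]]_n) (c : R[i]) (r : R).

Definition disc_in D a b c r :=
  [set l : R[i] | `|l - c| <= r%:C] `<=` [set l | D (a + l *: b)].

Lemma disc_in_circle D a b c r t :
  0 <= r -> disc_in D a b c r -> D (a + circle c r t *: b).
Proof. by move=> r0 h; apply: (h (circle c r t)); rewrite /= circle_dist. Qed.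

(** This measurability is what allows integrals of plurisubharmonic functions
    over circles to be compared, scaled and summed. *)
Lemma usc_circle_measurable D u a b c r :
  usc_on D u -> 0 <= r -> disc_in D a b c r ->
  measurable_fun (`[0%R, (2 * pi)%R]%classic : set R)
    (fun t => u (a + circle c r t *: b)).
Proof.
move=> uscu r0 disc.
apply: measurable_funTS.
set g := fun t => a + circle c r t *: b.
have gD : g @^-1` D = setT.
  by apply/seteqP; split=> // t _; exact: disc_in_circle disc.
rewrite -gD; apply: usc_on_measurable; first by rewrite gD.
apply: (@usc_on_comp R R _ D u g) => // t.
apply: (cvg_comp (circle c r) (fun l => a + l *: b)).
  exact: circle_continuous.
exact: line_continuous.
Qed.

Lemma psh_submean D u a b c r :
  psh D u -> 0 < r -> disc_in D a b c r ->
  (u (a + c *: b)%R <= circle_mean (fun l => u (a + l *: b)%R) c r)%E.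
Proof. by move=> [_ _ /(_ a b)[_ _ +]] r0 disc; apply. Qed.

Lemma psh_measurable D u a b c r :
  psh D u -> 0 < r -> disc_in D a b c r ->
  measurable_fun (`[0%R, (2 * pi)%R]%classic : set R)
    (fun t => u (a + circle c r t *: b)).
Proof. by move=> [_ uscu _] /ltW; exact: usc_circle_measurable. Qed.

(** Upper semicontinuity needs to be checked only on D: restricting to a
    complex line is composing with a continuous map. *)
Lemma pshI D u :
  (forall z, D z -> (u z < +oo)%E) -> usc_on D u ->
  (forall a b c r, 0 < r -> disc_in D a b c r ->
     (u (a + c *: b)%R <= circle_mean (fun l => u (a + l *: b)%R) c r)%E) ->
  psh D u.
Proof.
move=> uoo uscu submean; split => // a b; split.
- by move=> l; exact: uoo.
- exact: (usc_on_comp (@line_continuous R n a b) uscu).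
- by move=> c r r0 disc; exact: submean.
Qed.

Let k_ge0 : (0 <= ((2 * pi)^-1)%R%:E :> \bar R)%E.
Proof. by rewrite lee_fin invr_ge0 mulr_ge0 // pi_ge0. Qed.

Lemma le_circle_mean D u v a b c r :
  usc_on D u -> usc_on D v -> 0 < r -> disc_in D a b c r ->
  (forall z, D z -> (u z <= v z)%E) ->
  (circle_mean (fun l => u (a + l *: b)%R) c r <=
   circle_mean (fun l => v (a + l *: b)%R) c r)%E.
Proof.
move=> uscu uscv r0 disc uv; apply: lee_wpmul2l; first exact: k_ge0.
apply: le_integral_measurable => //.
- exact: usc_circle_measurable (ltW r0) disc.
- exact: usc_circle_measurable (ltW r0) disc.
- by move=> t _; apply/uv/(disc_in_circle _ (ltW r0) disc).
Qed.

Lemma circle_mean_cst (m : R) c r : circle_mean (fun=> m%:E) c r = m%:E.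
Proof.
rewrite /circle_mean integral_cst//= lebesgue_measure_itv /= lte_fin.
have pi2 : 0 < 2 * pi :> R by rewrite mulr_gt0 // pi_gt0.
rewrite pi2 sube0 -!EFinM mulrCA mulVf ?mulr1//; exact: lt0r_neq0.
Qed.

Lemma psh_cst D (m : R) : psh D (fun=> m%:E).
Proof.
apply: pshI.
- by move=> z _; exact: ltry.
- by move=> z Dz a ma; rewrite near_withinE; apply: nearW.
- by move=> a b c r _ _; rewrite circle_mean_cst.
Qed.

Lemma psh_max D u v : psh D u -> psh D v -> psh D (fun z => maxe (u z) (v z)).
Proof.
move=> pu pv; have [uoo uscu _] := pu; have [voo uscv _] := pv.
have uscm : usc_on D (fun z => maxe (u z) (v z)).
  move=> z Dz a; rewrite gt_max => /andP[uz vz].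
  near=> y; rewrite gt_max; apply/andP; split.
    by near: y; exact: uscu.
  by near: y; exact: uscv.
apply: pshI => //.
  by move=> z Dz; rewrite gt_max uoo ?voo.
move=> a b c r r0 disc; rewrite ge_max; apply/andP; split.
  apply: (le_trans (psh_submean pu r0 disc)).
  by apply: (le_circle_mean (D := D) (v := fun z => maxe (u z) (v z))) => // z _;
    rewrite le_max lexx.
apply: (le_trans (psh_submean pv r0 disc)).
by apply: (le_circle_mean (D := D) (v := fun z => maxe (u z) (v z))) => // z _;
  rewrite le_max lexx orbT.
Unshelve. all: by end_near. Qed.

(** For nonpositive functions means are computed through integrals of
    nonnegative functions, for which linearity and countable additivity hold
    without any integrability assumption. *)
Lemma circle_mean_le0 (f : R[i] -> \bar R) c r :
  (forall t, (f (circle c r t) <= 0)%E) ->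
  circle_mean f c r =
  (- (((2 * pi)^-1)%R%:E *
      \int[lebesgue_measure]_(t in `[0%R, (2 * pi)%R]) - f (circle c r t)))%E.
Proof.
move=> f0; rewrite /circle_mean.
under eq_integral do rewrite -[f _]oppeK.
by rewrite integral_ge0N ?muleN // => t _; rewrite oppe_ge0.
Qed.

Lemma psh_scale D u (e : R) : 0 < e -> (forall z, D z -> (u z <= 0)%E) ->
  psh D u -> psh D (fun z => e%:E * u z)%E.
Proof.
move=> e0 u0 pu; have [uoo uscu _] := pu; apply: pshI.
- move=> z Dz; apply: (@le_lt_trans _ _ 0%E) => //.
  by apply: mule_ge0_le0; [rewrite lee_fin ltW|exact: u0].
- move=> z Dz a; rewrite -lte_pdivlMl // => uz.
  near=> y; rewrite -lte_pdivlMl // -EFinM; near: y.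
  by apply: uscu => //; rewrite EFinM.
- move=> a b c r r0 disc.
  have u0' t : (u (a + circle c r t *: b)%R <= 0)%E.
    exact/u0/(disc_in_circle _ (ltW r0) disc).
  rewrite circle_mean_le0; last first.
    by move=> t; apply: mule_ge0_le0; [rewrite lee_fin ltW|exact: u0'].
  under eq_integral do rewrite -muleN.
  rewrite ge0_integralZl //; last first.
  + by rewrite lee_fin ltW.
  + by move=> t _; rewrite oppe_ge0.
  + by apply: measurableT_comp => //; exact: psh_measurable pu r0 disc.
  rewrite muleCA -muleN; apply: lee_wpmul2l; first by rewrite lee_fin ltW.
  rewrite -(@circle_mean_le0 (fun l => u (a + l *: b))) //.
  exact: (psh_submean pu r0 disc).
Unshelve. all: by end_near. Qed.

(** The usual splitting of a strict bound f + g < a works as long as no summand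
    is +oo; a summand equal to -oo at the point leaves all the room to the
    other one. *)
Lemma usc_on_sum D (u_ : nat -> 'rV[R[i]]_n -> \bar R) N :
  (forall j, usc_on D (u_ j)) -> (forall j z, D z -> (u_ j z < +oo)%E) ->
  usc_on D (fun z => \sum_(0 <= j < N) u_ j z)%E.
Proof.
move=> uscu uoo; elim: N => [|N IH] z Dz a.
  by rewrite big_nil => a0; apply: nearW => y; rewrite big_nil.
rewrite big_nat_recr //=.
have := uoo N z Dz; case uNz : (u_ N z) => [x| |] // _ h.
- set s := (\sum_(0 <= j < N) u_ j z)%E in h.
  have [d d0 sd] : exists2 d : R, 0 < d & (s < (a - x - d)%:E)%E.
    move: h; case: s => [s| |] //=.
      rewrite -EFinD lte_fin => h; exists ((a - x - s) / 2).
        by rewrite divr_gt0 // subr_gt0 ltrBrDr.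
      rewrite lte_fin ltrBrDl -ltrBrDr ltr_pdivrMr // ltr_pMr ?ltr1n //.
      by rewrite subr_gt0 ltrBrDr.
    by move=> _; exists 1 => //; exact: ltNyr.
  have xd : (u_ N z < (x + d)%:E)%E by rewrite uNz lte_fin ltrDl.
  near=> y; rewrite big_nat_recr //=.
  have -> : a = (a - x - d) + (x + d) by ring.
  rewrite EFinD; apply: lteD; near: y; [exact: IH|exact: uscu].
- pose s := (\sum_(0 <= j < N) u_ j z)%E.
  have [m sm] : exists m : R, (s < m%:E)%E.
    have : (s < +oo)%E.
      rewrite /s; elim/big_ind: _ => //.
        by move=> p q; exact: lte_add_pinfty.
      by move=> j _; exact: uoo.
    case: (s) => [x _| |] //.
      by exists (x + 1); rewrite lte_fin ltrDl.
    by move=> _; exists 0; exact: ltNyr.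
  have xd : (u_ N z < (a - m)%:E)%E by rewrite uNz; exact: ltNyr.
  near=> y; rewrite big_nat_recr //=.
  rewrite (_ : a = m + (a - m)); last by rewrite addrC subrK.
  rewrite EFinD; apply: lteD; near: y; [exact: IH|exact: uscu].
Unshelve. all: by end_near. Qed.

End Plurisubharmonic.

(** * Series of nonpositive functions *)

Section Series.
Context {R : realType} {n : nat}.
Implicit Types (D : set 'rV[R[i]]_n).

(** The sum of the u_j, written with two signs because infinite sums of
    nonnegative extended reals always converge. *)
Definition series_le0 (u_ : nat -> 'rV[R[i]]_n -> \bar R) z : \bar R :=
  (- \sum_(0 <= j <oo) - u_ j z)%E.

Lemma series_le0_partial D (u_ : nat -> 'rV[R[i]]_n -> \bar R) N z :
  (forall j w, D w -> (u_ j w <= 0)%E) -> D z ->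
  (series_le0 u_ z <= \sum_(0 <= j < N) u_ j z)%E.
Proof.
move=> u0 Dz; rewrite /series_le0 leeNl -sumeN; last first.
  by move=> i j _ _; apply: ltpinfty_adde_def; rewrite inE;
    apply: (@le_lt_trans _ _ 0%E); rewrite ?u0.
by apply: nneseries_lim_ge => j _ _; rewrite oppe_ge0 u0.
Qed.

(** The series is the infimum of its partial sums, so a strict upper bound is
    already achieved by one of them; upper semicontinuity of the sum comes from
    this. *)
Lemma series_le0_lt D (u_ : nat -> 'rV[R[i]]_n -> \bar R) z (a : R) :
  (forall j w, D w -> (u_ j w <= 0)%E) -> D z -> (series_le0 u_ z < a%:E)%E ->
  exists N, (\sum_(0 <= j < N) u_ j z < a%:E)%E.
Proof.
move=> u0 Dz; apply: contraPP => /forallNP h; apply/negP; rewrite -leNgt.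
rewrite /series_le0 leeNr; apply: lime_le.
  by apply: is_cvg_nneseries => j _ _; rewrite oppe_ge0 u0.
apply: nearW => N; rewrite sumeN.
  by rewrite leeN2 leNgt; apply/negP.
by move=> i j _ _; apply: ltpinfty_adde_def; rewrite inE;
    apply: (@le_lt_trans _ _ 0%E); rewrite ?u0.
Qed.

(** The series is a decreasing limit of its partial sums: upper semicontinuity
    is inherited from these, and the mean value inequality follows by
    exchanging integral and sum (monotone convergence). *)
Lemma psh_series D (u_ : nat -> 'rV[R[i]]_n -> \bar R) :
  (forall j w, D w -> (u_ j w <= 0)%E) -> (forall j, psh D (u_ j)) ->
  psh D (series_le0 u_).
Proof.
move=> u0 pu.
have s0 z : D z -> (series_le0 u_ z <= 0)%E.
  by move=> Dz; have := series_le0_partial 0 u0 Dz; rewrite big_geq.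
apply: pshI.
- by move=> z Dz; exact: le_lt_trans (s0 _ Dz) _.
- move=> z Dz a /(series_le0_lt u0 Dz)[N hN].
  have uscN : usc_on D (fun w => \sum_(0 <= j < N) u_ j w)%E.
    by apply: usc_on_sum => j; have [? ? _] := pu j.
  have := uscN z Dz a hN; rewrite !near_withinE.
  apply: filterS => w h Dw.
  exact: le_lt_trans (series_le0_partial N u0 Dw) (h Dw).
- move=> a b c r r0 disc.
  have k0 : 0 <= (2 * pi)^-1 :> R by rewrite invr_ge0 mulr_ge0 // pi_ge0.
  have uc0 j t : (u_ j (a + circle c r t *: b)%R <= 0)%E.
    exact/u0/(disc_in_circle _ (ltW r0) disc).
  rewrite circle_mean_le0; last first.
    by move=> t; apply/s0/(disc_in_circle _ (ltW r0) disc).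
  rewrite /series_le0 leeN2.
  under eq_integral do rewrite oppeK.
  rewrite integral_nneseries //; first last.
  + by move=> j t _; rewrite oppe_ge0.
  + move=> j; apply: measurableT_comp => //.
    exact: psh_measurable (pu j) r0 disc.
  rewrite -nneseriesZl; last first.
    by move=> j _; apply: integral_ge0 => t _; rewrite oppe_ge0.
  apply: lee_nneseries.
    move=> j _ _; apply: mule_ge0; first by rewrite lee_fin.
    by apply: integral_ge0 => t _; rewrite oppe_ge0.
  move=> j _; rewrite leeNr.
  rewrite -(@circle_mean_le0 _ (fun l => u_ j (a + l *: b))) //.
  exact: (psh_submean (pu j) r0 disc).
Qed.

End Series.

(** * A quantitative mean value inequality and the maximum principle *)

Section MaximumPrinciple.
Context {R : realType} {n : nat}.
Implicit Types (D U : set 'rV[R[i]]_n) (u : 'rV[R[i]]_n -> \bar R).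

Lemma integral_arc (f : R -> \bar R) (M L eta : R) :
  measurable_fun (`[0, 2 * pi]%classic : set R) f ->
  0 < eta <= 2 * pi -> (forall t, (f t <= M%:E)%E) ->
  (forall t, 0 <= t <= eta -> (f t <= (M - L)%:E)%E) ->
  (\int[lebesgue_measure]_(t in `[0%R, (2 * pi)%R]) f t <=
     (M * (2 * pi) - L * eta)%:E)%E.
Proof.
move=> mf /andP[eta0 eta2pi] fM fML.
have split_itv : `[0, 2 * pi]%classic = `[0, eta] `|` `]eta, 2 * pi] :> set R.
  by rewrite -itv_bndbnd_setU // bnd_simp // ltW.
rewrite split_itv integral_setU //=; first last.
- apply/disj_setPS => t [] /=; rewrite !in_itv/= => /andP[_ te] /andP[et _].
  by move: (lt_le_trans et te); rewrite ltxx.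
- by rewrite -split_itv.
have -> : M * (2 * pi) - L * eta = (M - L) * eta + M * (2 * pi - eta) by ring.
rewrite EFinD; apply: leeD.
- have -> : ((M - L) * eta)%:E =
      (\int[lebesgue_measure]_(t in `[0%R, eta]) (M - L)%:E)%E.
    by rewrite integral_cst//= lebesgue_measure_itv/= lte_fin eta0 sube0.
  apply: le_integral_measurable => //.
    by apply: measurable_funS mf => //; rewrite split_itv; exact: subsetUl.
- have -> : (M * (2 * pi - eta))%:E =
      (\int[lebesgue_measure]_(t in `]eta, (2 * pi)%R]) M%:E)%E.
    rewrite integral_cst//= lebesgue_measure_itv/= lte_fin.
    case: ltP => [_|h]; first by rewrite EFinM EFinB.
    have -> : eta = 2 * pi by apply/eqP; rewrite eq_le eta2pi.
    by rewrite subrr mulr0 mule0.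
  apply: le_integral_measurable => //.
  by apply: measurable_funS mf => //; rewrite split_itv; exact: subsetUr.
Qed.

(** If u <= M on D and u is smaller than M by at least L near one point of a
    circle, then at the center u is smaller than M by at least L kappa, where
    2 pi kappa is the angle of an arc starting at that point.  As kappa does not
    depend on u, M, L, taking L arbitrarily large handles the value -oo. *)
Lemma psh_submean_near D U (a b : 'rV[R[i]]_n) (c : R[i]) (r : R) :
  0 < r -> disc_in D a b c r -> nbhs (a + circle c r 0 *: b) U ->
  exists2 kappa : R, 0 < kappa & forall u (M L : R), psh D u ->
    (forall z, D z -> (u z <= M%:E)%E) ->
    (forall z, D z -> U z -> (u z <= (M - L)%:E)%E) ->
    (u (a + c *: b)%R <= (M - L * kappa)%:E)%E.
Proof.
move=> r0 disc Unear.
pose g t := a + circle c r t *: b.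
have gcont : {for 0, continuous g}.
  apply: (cvg_comp (circle c r) (fun l => a + l *: b)).
    exact: circle_continuous.
  exact: line_continuous.
have pi2 : 0 < 2 * pi :> R by rewrite mulr_gt0 // pi_gt0.
have [e e0 ge] : exists2 e : R, 0 < e & forall t, 0 <= t <= e -> U (g t).
  have := gcont _ Unear => /nbhs_ballP[e /= e0 he]; exists (e / 2).
    by rewrite divr_gt0.
  move=> t /andP[t0 te]; apply: he; rewrite /ball /= sub0r normrN ger0_norm //.
  by rewrite (le_lt_trans te) // ltr_pdivrMr // ltr_pMr // ltr1n.
pose eta := Num.min e (2 * pi).
have eta0 : 0 < eta by rewrite lt_min e0.
exists (eta / (2 * pi)); first by rewrite divr_gt0.
move=> u M L pu uM uML.
apply: (le_trans (psh_submean pu r0 disc)).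
have -> : (M - L * (eta / (2 * pi)))%:E =
    (((2 * pi)^-1)%R%:E * (M * (2 * pi) - L * eta)%:E)%E :> \bar R.
  rewrite -EFinM; congr EFin; move: (lt0r_neq0 pi2); move: (2 * pi) => P P0.
  by field.
apply: lee_wpmul2l; first by rewrite lee_fin invr_ge0 ltW.
have Dg t : D (g t) by exact: disc_in_circle (ltW r0) disc.
apply: integral_arc.
- exact: psh_measurable pu r0 disc.
- by rewrite eta0 ge_min lexx orbT.
- by move=> t; exact/uM/Dg.
- move=> t /andP[t0 te]; apply: uML; [exact: Dg|apply: ge; rewrite t0].
  by rewrite (le_trans te) // ge_min lexx.
Qed.

(** The set W of points near which u is -oo is open; it is also closed in D.
    Indeed if q in W is close to a limit z of W, then for every w near z the
    circle centered at w through q, in the complex line joining them, lies in D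
    and meets W, so that the mean value inequality forces u w = -oo. *)
Lemma psh_ninfty_propagation D u p U :
  open D -> connected D -> psh D u -> (forall z, D z -> (u z <= 0)%E) ->
  D p -> nbhs p U -> (forall z, D z -> U z -> u z = -oo%E) ->
  forall z, D z -> u z = -oo%E.
Proof.
move=> oD cD pu u0 Dp pU uU.
pose N := [set z | D z -> u z = -oo%E].
pose W := D `&` N°.
suff -> : D = W by move=> z [Dz /interior_subset]; exact.
apply/esym/cD.
- exists p; split => //.
  by move: pU; apply: filterS => z Uz Dz; exact: uU.
- by exists N° => //; exact: open_interior.
- exists (closure W); first exact: closed_closure.
  apply/seteqP; split => [z Wz|z [Dz clz]].
    by split; [case: Wz|exact: subset_closure].
  split => //; rewrite /interior /=; apply/nbhs_rnorm.
  have /nbhs_rnorm[rho rho0 rhoD] : nbhs z D by exact: open_nbhs_nbhs.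
  have r0 : 0 < rho / 3 by rewrite divr_gt0.
  (* the radius rho / 3 keeps the unit disc of the line l |-> w + l (q - w),
     whose points are at distance < 3 (rho / 3) from z, inside D *)
  have /clz[q [[Dq qN] /= zq]] : nbhs z [set y | rnorm (z - y) < rho / 3].
    by apply/nbhs_rnorm; exists (rho / 3).
  exists (rho / 3) => // w zw Dw.
  have disc : disc_in D w (q - w) 0 1.
    move=> l /=; rewrite subr0 => l1; apply: rhoD.
    rewrite opprD addrA; apply: le_lt_trans (rnormD _ _) _.
    rewrite rnormN rnormZ.
    have qw : rnorm (q - w) < rho / 3 + rho / 3.
      apply: le_lt_trans (rdistD _ z _) _; apply: ltrD => //.
      by rewrite rdistC.
    have l1' : 0 <= complex.Re `|l| <= 1.
      by rewrite -!lecR RRe_real ?ger0_real ?normr_ge0.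
    have : complex.Re `|l| * rnorm (q - w) <= rnorm (q - w).
      by case/andP: l1' => ? ?; rewrite ler_piMl // rnorm_ge0.
    by move: zw qw => /=; lra.
  have [|kappa kappa0 /(_ u 0 _ pu u0) uL] :=
    @psh_submean_near D N w (q - w) 0 1 ltr01 disc.
    by rewrite /circle cos0 sin0 mul1r add0r scale1r addrC subrK.
  have {}uL (L : R) : (u w <= (- (L * kappa))%:E)%E.
    rewrite -[- _]add0r -[in leLHS](addr0 w) -[X in w + X](scale0r (q - w)).
    by apply: uL => y Dy Ny; rewrite Ny // leNye.
  move: uL (u0 _ Dw); case: (u w) => [x|/(_ 0)|] // uL _.
  (* for this choice of L the bound reads x <= x - 1 *)
  have := uL ((1 - x) / kappa).
  by rewrite lee_fin mulfVK ?lt0r_neq0 // => h; exfalso; lra.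
Qed.

Lemma psh_finite_dense D u z U :
  open D -> connected D -> psh D u -> (forall z, D z -> (u z <= 0)%E) ->
  not_identically_ninfty D u -> closure D z -> nbhs z U ->
  exists w, [/\ D w, U w & u w != -oo%E].
Proof.
move=> oD cD pu u0 [p Dp up] clz zU; apply: contrapT => noW.
have /clz[q [Dq qU]] : nbhs z U° by exact: nbhs_interior.
have uE := psh_ninfty_propagation oD cD pu u0 Dq qU.
move: up; rewrite uE ?eqxx // => w Dw Uw; apply: contrapT => /eqP uw.
by apply: noW; exists w.
Qed.

Lemma rnorm_coord (w : 'rV[R[i]]_n) j : `|w ord0 j| <= (rnorm w)%:C.
Proof.
rewrite -rnormE {2}/Num.norm /= mx_normE.
rewrite [`|_|](_ : _ = `|w ord0 j|%:nng%:num) // num_le.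
exact: (le_bigmax _ (fun ij : 'I_1 * 'I_n => `|w ij.1 ij.2|%:nng) (ord0, j)).
Qed.

(** A box is the image of a product of two real segments. *)
Lemma compact_complex_box (e : R) :
  compact [set z : R[i] | `|complex.Re z| <= e /\ `|complex.Im z| <= e].
Proof.
pose f (x : R * R) : R[i] := x.1%:C + 'i%C * x.2%:C.
have -> : [set z : R[i] | `|complex.Re z| <= e /\ `|complex.Im z| <= e] =
    f @` (`[(- e), e]%classic `*` `[(- e), e]%classic).
  apply/seteqP; split => [z [/= rez imz]|_ [[x y] [/= xe ye] <-]].
    exists (complex.Re z, complex.Im z); last by rewrite /f /= -complexE.
    by split; rewrite /= in_itv /= -ler_norml.
  move: xe ye; rewrite !in_itv /= -!ler_norml => xe ye.
  by rewrite /f /=; simpc => /=.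
apply: continuous_compact.
  apply: continuous_subspaceT => x.
  apply: cvgD.
    apply: (cvg_comp fst (fun y : R => y%:C)); first exact: cvg_fst.
    exact: real_complex_continuous.
  apply: cvgM; first exact: cvg_cst.
  apply: (cvg_comp snd (fun y : R => y%:C)); first exact: cvg_snd.
  exact: real_complex_continuous.
by apply: compact_setX; exact: segment_compact.
Qed.

Lemma bounded_set_rnorm D : bounded_set D ->
  exists e : R, forall w, D w -> rnorm w <= e.
Proof.
move=> /pinfty_ex_gt0[M M0 DM]; exists (complex.Re M) => w Dw.
have M_real : (complex.Re M)%:C = M by rewrite RRe_real // realE ltW.
by rewrite -lecR -rnormE M_real; exact: DM.
Qed.

Lemma bounded_closure_compact D : bounded_set D -> compact (closure D).
Proof.
move=> /bounded_set_rnorm[e De].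
pose box := [set z : R[i] |
  `|complex.Re z| <= e + 1 /\ `|complex.Im z| <= e + 1].
have := @rV_compact R[i] n (fun=> box) (fun=> @compact_complex_box (e + 1)).
move=> cbox; apply: (subclosed_compact _ cbox); first exact: closed_closure.
move=> w clw j.
  have /clw[y [Dy wy]] : nbhs w [set y | rnorm (w - y) < 1].
    by apply/nbhs_rnorm; exists 1.
  have wj : `|w ord0 j| <= (e + 1)%:C.
    apply: le_trans (rnorm_coord w j) _; rewrite lecR -[w](subrK y).
    apply: le_trans (rnormD _ _) _; rewrite addrC lerD ?De //; exact: ltW.
  split; rewrite -lecR; apply: le_trans wj; first exact: normc_ge_Re.
  rewrite [leRHS]normc_def lecR -sqrtr_sqr ler_sqrt.
    by rewrite lerDr sqr_ge0.
  by rewrite addr_ge0 ?sqr_ge0.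
Qed.

Lemma Re_coord_continuous (j : 'I_n) :
  continuous (fun w : 'rV[R[i]]_n => complex.Re (w ord0 j)).
Proof.
move=> w U /nbhs_ballP[e /= e0 eU]; apply/nbhs_rnorm; exists e => // y wy.
apply: eU; rewrite /ball /=; apply: le_lt_trans wy.
rewrite -lecR; apply: le_trans (rnorm_coord _ j).
by rewrite !mxE -raddfB; exact: normc_ge_Re.
Qed.

(** Suppose F exceeds m somewhere in D.  Then F attains its maximum M over the
    compact set closure D, and the compact set K = {F = M} is contained in D.
    Let q be a point of K whose j-th coordinate has maximal real part.  A small
    circle centered at q in the direction of the j-th coordinate axis contains a
    point with larger real part, hence not in K: there F < M, and the mean
    value inequality gives F q < M. *)
Lemma maximum_principle D (F : 'rV[R[i]]_n -> R) (m : R) :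
  (0 < n)%N -> open D -> bounded_set D ->
  {within closure D, continuous F} -> psh D (fun z => (F z)%:E) ->
  (forall x, boundary D x -> F x <= m) -> forall z, D z -> F z <= m.
Proof.
move=> n0 oD bD cF pF Fm z Dz; rewrite leNgt; apply/negP => mFz.
have cD := bounded_closure_compact bD.
have clD w : D w -> closure D w by exact: subset_closure.
have [p /set_mem clp maxp] : exists2 p, p \in closure D &
    forall w, w \in closure D -> F w <= F p.
  by apply: compact_EVT_max => //; exists z; exact: clD.
pose K := closure D `&` [set w | F w = F p].
have KD w : K w -> D w.
  move=> [clw Fw]; apply: contrapT => nDw.
  have /Fm : boundary D w by split => // /interior_subset.
  have := maxp z (mem_set (clD _ Dz)); rewrite -Fw => zw wm.
  by have := lt_le_trans mFz (le_trans zw wm); rewrite ltxx.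
have cK : compact K.
  apply: (subclosed_compact _ cD); last by move=> w [].
  move=> w clKw.
  have clw : closure D w.
    apply: (@closed_closure _ D); move: clKw; apply: closureS.
    exact: subIsetl.
  split => //=; apply/eqP; rewrite eq_le maxp ?mem_set //= leNgt.
  apply/negP => wp.
  have /(_ clw) := (subspace_continuousP _ _).1 cF w.
  move=> /cvgrPdist_lt/(_ (F p - F w)); rewrite subr_gt0 => /(_ wp).
  rewrite near_withinE => /clKw[y [[cly /= Fy]]] /(_ cly).
  rewrite [from_subspace _ F y]Fy ltr_norml => /andP[+ _].
  by rewrite opprB ltrD2l ltxx.
pose j : 'I_n := Ordinal n0.
have [q /set_mem Kq maxq] : exists2 q, q \in K &
    forall w, w \in K -> complex.Re (w ord0 j) <= complex.Re (q ord0 j).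
  apply: compact_EVT_max => //; first by exists p.
  by apply: continuous_subspaceT; exact: Re_coord_continuous.
have Dq := KD _ Kq.
have /nbhs_rnorm[e e0 eD] : nbhs q D by exact: open_nbhs_nbhs.
pose b : 'rV[R[i]]_n := delta_mx ord0 j.
pose r := e / (rnorm b + 1).
have b0 : 0 < rnorm b + 1 by rewrite ltr_wpDl // rnorm_ge0.
have r0 : 0 < r by rewrite divr_gt0.
have disc : disc_in D q b 0 r.
  move=> l /=; rewrite subr0 => lr; apply: eD.
  rewrite opprD addrA subrr sub0r rnormN rnormZ.
  have lr' : complex.Re `|l| <= r by rewrite -lecR RRe_real ?ger0_real.
  apply: (@le_lt_trans _ _ (r * rnorm b)).
    by rewrite ler_wpM2r // rnorm_ge0.
  by rewrite /r mulrAC ltr_pdivrMr // ltr_pM2l // ltrDl.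
pose q' := q + circle 0 r 0 *: b.
have Dq' : D q' by exact: disc_in_circle (ltW r0) disc.
have Fq' : F q' < F p.
  have q'p : F q' <= F p by exact/maxp/mem_set/clD.
  rewrite lt_neqAle q'p andbT; apply/eqP => Fq'.
  have := maxq q' (mem_set (conj (clD _ Dq') Fq')).
  rewrite /q' /b !mxE !eqxx /circle cos0 sin0 add0r mulr1.
  by rewrite raddfD /= mulr1 mul0r subr0 gerDl leNgt r0.
pose L := (F p - F q') / 2.
have L0 : 0 < L by rewrite divr_gt0 // subr_gt0.
pose U := [set w | D w -> F w <= F p - L].
have Uq' : nbhs q' U.
  have [_ uscF _] := pF.
  have := uscF q' Dq' (F p - L); rewrite lte_fin /L near_withinE => h.
  have {}h := h ltac:(lra).
  by apply: filterS h => w h Dw; have := h Dw; rewrite lte_fin => /ltW.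
have [kappa kappa0 ] := psh_submean_near r0 disc Uq'.
move=> /(_ _ (F p) L pF); rewrite scale0r addr0 lee_fin => h.
have : F q <= F p - L * kappa.
  apply: h => w Dw; rewrite lee_fin; first by apply/maxp/mem_set/clD.
  by apply.
by case: Kq => _ /= ->; rewrite lerDl oppr_ge0 leNgt mulr_gt0.
Qed.

End MaximumPrinciple.

(** * Upper regularization at boundary points *)

Section UpperRegularization.
Context {R : realType} {n : nat}.
Implicit Types (D A : set 'rV[R[i]]_n) (u v : 'rV[R[i]]_n -> \bar R).

Lemma ustar_lt D u x (a : \bar R) : (ustar D u x < a)%E ->
  \forall y \near within D (nbhs x), (u y < a)%E.
Proof.
move=> /ereal_inf_lt[_ [V xV <-] Va]; apply: filterS xV => y Vy.
by apply: le_lt_trans Va; apply: ereal_sup_ubound; exists y.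
Qed.

Lemma ustar_le D u x (a : \bar R) :
  (\forall y \near within D (nbhs x), (u y <= a)%E) -> (ustar D u x <= a)%E.
Proof.
move=> xa; apply: (@le_trans _ _ (ereal_sup (u @` [set y | (u y <= a)%E]))).
  by apply: ereal_inf_lbound; exists [set y | (u y <= a)%E].
by apply: ge_ereal_sup => _ [y ya <-].
Qed.

Lemma ustar_ge D u x (a : \bar R) :
  (forall U, nbhs x U -> exists y, [/\ D y, U y & (a <= u y)%E]) ->
  (a <= ustar D u x)%E.
Proof.
move=> h; apply: le_ereal_inf_tmp => _ [V xV <-].
have [y [Dy Vy ay]] := h _ xV.
by apply: le_trans ay _; apply: ereal_sup_ubound; exists y => //; exact: Vy.
Qed.

Lemma ustar_ninfty D u x :
  (forall m : R, \forall y \near within D (nbhs x), (u y <= m%:E)%E) ->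
  ustar D u x = -oo%E.
Proof. by move=> h; apply: eq_ninfty => m; exact: ustar_le. Qed.

Lemma ustar_ge_val D u z : D z -> (u z <= ustar D u z)%E.
Proof.
by move=> Dz; apply: ustar_ge => U zU; exists z; split => //;
  exact: nbhs_singleton.
Qed.

(** Near x the first N + k terms add up to at most - k / 2, because each of the
    last k of them is below - 1 / 2. *)
Lemma ustar_series D (u_ : nat -> 'rV[R[i]]_n -> \bar R) x N :
  (forall j w, D w -> (u_ j w <= 0)%E) ->
  (forall j, (N <= j)%N -> (ustar D (u_ j) x <= (-1)%:E)%E) ->
  ustar D (series_le0 u_) x = -oo%E.
Proof.
move=> u0 uN; apply: ustar_ninfty => m.
have partial k : \forall y \near within D (nbhs x),
    (\sum_(0 <= j < N + k) u_ j y <= (- (k%:R / 2))%:E)%E.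
  elim: k => [|k IH].
    rewrite near_withinE; apply: nearW => y Dy.
    by rewrite mul0r oppr0; apply: sume_le0 => j _; exact: u0.
  have uk : \forall y \near within D (nbhs x), (u_ (N + k)%N y < (- 2^-1)%:E)%E.
    apply: ustar_lt; apply: le_lt_trans (uN _ (leq_addr _ _)) _.
    by rewrite lte_fin; lra.
  apply: filterS2 IH uk => y IH /ltW uk.
  rewrite addnS big_nat_recr //=.
  have -> : - (k.+1%:R / 2) = - (k%:R / 2) + - 2^-1 :> R.
    by rewrite -natr1 mulrDl mul1r opprD.
  by rewrite EFinD; exact: leeD.
have [k mk] : exists k : nat, - m * 2 < k%:R.
  exists (Num.bound `|- m * 2|).
  exact: le_lt_trans (ler_norm _) (archi_boundP (normr_ge0 _)).
have := partial k; rewrite !near_withinE; apply: filterS => y h Dy.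
apply: le_trans (series_le0_partial (N + k) u0 Dy) _.
by apply: le_trans (h Dy) _; rewrite lee_fin; lra.
Qed.

Lemma series_le0_ge (u_ : nat -> 'rV[R[i]]_n -> \bar R) z :
  (forall j, (u_ j z <= 0)%E) ->
  (forall j, ((- (1 / (2 ^ j.+1)%:R))%:E <= u_ j z)%E) ->
  ((-1)%:E <= series_le0 u_ z)%E.
Proof.
move=> u0 uj; rewrite /series_le0 leeNr.
rewrite -EFinN opprK; apply: le_trans (epsilon_trick0 xpredT ler01).
apply: lee_nneseries => j; first by move=> _ _; rewrite oppe_ge0.
by move=> _; rewrite leeNl -EFinN.
Qed.

(** The constant -1/2 is put in front of the u_j to make the sum strictly
    negative; the bound -1 is -1/2 plus the sum over j of - 2^-(j+2). *)
Lemma psh_pluripolar_witness D A (u_ : nat -> 'rV[R[i]]_n -> \bar R) :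
  (forall j, psh D (u_ j)) -> (forall j w, D w -> (u_ j w <= 0)%E) ->
  (forall x, A x -> exists N, forall j, (N <= j)%N ->
     (ustar D (u_ j) x <= (-1)%:E)%E) ->
  exists w, [/\ psh D w, forall z, D z -> (w z < 0)%E,
    forall x, A x -> ustar D w x = -oo%E &
    forall z, D z -> (forall j, ((- (1 / (2 ^ j.+2)%:R))%:E <= u_ j z)%E) ->
      ((-1)%:E <= w z)%E].
Proof.
move=> pu u0 uA.
pose v_ j := if j is j'.+1 then u_ j' else fun=> (- (1 / 2))%:E.
have v0 j w : D w -> (v_ j w <= 0)%E.
  by case: j => [_|j]; [rewrite lee_fin; lra|exact: u0].
exists (series_le0 v_); split.
- by apply: psh_series => // -[|j]; [exact: psh_cst|exact: pu].
- move=> z Dz; apply: le_lt_trans (series_le0_partial 1 v0 Dz) _.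
  by rewrite big_nat1 /= lte_fin; lra.
- move=> x /uA[N uN]; apply: (@ustar_series _ _ _ N.+1) => // -[|j] //.
  exact: uN.
- move=> z Dz uz; apply: series_le0_ge => j; first exact: v0.
  by case: j => [|j]; [rewrite /= expn1 lexx|exact: uz].
Qed.

End UpperRegularization.

(** * The hull *)

Section Hull.
Context {R : realType} {n : nat}.
Implicit Types (D A : set 'rV[R[i]]_n) (u v : 'rV[R[i]]_n -> \bar R).

(** If u z were finite, the competitors eps u with eps -> 0 would give
    omega z A D >= 0. *)
Lemma omega_lt0_hull D A z : D z -> (omega z A D < 0)%E ->
  b_pluripolar_hull D A z.
Proof.
move=> Dz oz; split; first exact: subset_closure.
move=> u pu _ u0 uA.
suff uz : u z = -oo%E.
  apply: ustar_ninfty => m; have [_ uscu _] := pu.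
  have := uscu z Dz m; rewrite uz => /(_ (ltNyr _)).
  by apply: filterS => y /ltW.
apply: contrapT => /eqP uz; move: oz; apply/negP; rewrite -leNgt.
have u0' w : D w -> (u w <= 0)%E by move=> /u0/ltW.
have scaled (e : R) : 0 < e -> (e%:E * u z <= omega z A D)%E.
  move=> e0; apply: ereal_sup_ubound; exists (fun w => e%:E * u w)%E => //.
  split; first exact: psh_scale.
    by move=> w /u0' uw; apply: mule_ge0_le0 => //; rewrite lee_fin ltW.
  move=> x Ax; apply: ustar_le.
  have : (ustar D u x < (e^-1 * -1)%:E)%E by rewrite uA // ltNyr.
  move=> /ustar_lt; apply: filterS => y /ltW.
  by rewrite EFinM lee_pdivlMl.
move: uz scaled (u0 _ Dz); case: (u z) => [x| |] // _ scaled.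
rewrite lte_fin => x0.
apply/lee_addgt0Pr => e e0.
(* the competitor (e / - u z) u takes the value - e at z *)
have := scaled (e / - x); rewrite divr_gt0 ?oppr_gt0 // => /(_ isT).
have -> : ((e / - x)%:E * x%:E = (- e)%:E :> \bar R)%E.
  by rewrite -EFinM; congr EFin; field; rewrite lt_eqF.
by move=> h; rewrite -leeBlDr // sub0e.
Qed.

(** When omega z A D >= 0, competitors with values above - 2^-(j+2) at z exist
    for every j; their sum is finite at z. *)
Lemma hull_omega_lt0 D A z : D z -> b_pluripolar_hull D A z ->
  (omega z A D < 0)%E.
Proof.
move=> Dz [_ hull]; rewrite ltNge; apply/negP => o0.
have u_ex (j : nat) : exists u, [/\ psh D u, forall w, D w -> (u w <= 0)%E,
    forall x, A x -> (ustar D u x <= (-1)%:E)%E &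
    ((- (1 / (2 ^ j.+2)%:R))%:E <= u z)%E].
  have : ((- (1 / (2 ^ j.+2)%:R))%:E < omega z A D)%E.
    apply: lt_le_trans o0.
    by rewrite lte_fin oppr_lt0 divr_gt0 // ltr0n expn_gt0.
  by move=> /ereal_sup_gt[_ [u [pu u0 uA] <-] /ltW uz]; exists u.
have /choice[u_ uP] := u_ex.
have [|||w [pw w0 wA wz]] := @psh_pluripolar_witness R n D A u_.
- by move=> j; have [] := uP j.
- by move=> j; have [] := uP j.
- by move=> x Ax; exists 0 => j _; have [_ _ + _] := uP j; exact.
have {}wz : ((-1)%:E <= w z)%E by apply: wz => // j; have [] := uP j.
have := ustar_ge_val w Dz; rewrite hull //.
  by rewrite leNgt (lt_le_trans _ wz) // ltNyr.
by exists z => //; apply/eqP => wE; move: wz; rewrite wE.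
Qed.

Lemma distance_continuous (z : 'rV[R[i]]_n) :
  continuous (fun x : 'rV[R[i]]_n => - rnorm (x - z)).
Proof.
move=> x U /nbhs_ballP[e /= e0 eU]; apply/nbhs_rnorm; exists e => // y xy.
apply: eU; rewrite /ball /=; apply: le_lt_trans xy.
have := rdistD x y z; have := rdistD y x z; rewrite (rdistC y x).
rewrite ler_norml => yx xy; apply/andP; split; lra.
Qed.

(** On a B-regular domain every boundary point z admits a plurisubharmonic peak
    function; the boundary values - |x - z| are chosen because they vanish only
    at z. *)
Lemma peak_function D z : (0 < n)%N -> B_regular D -> boundary D z ->
  exists F : 'rV[R[i]]_n -> R,
    [/\ {within closure D, continuous F}, psh D (fun w => (F w)%:E),
        forall w, D w -> F w <= 0 &
        forall x, boundary D x -> F x = - rnorm (x - z)].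
Proof.
move=> n0 [[oD _ _ bD] Dext] bz.
have [|F [cF FE pF]] := Dext (fun x => - rnorm (x - z)).
  exact/continuous_subspaceT/distance_continuous.
exists F; split => //.
apply: maximum_principle => // x bx.
by rewrite FE // oppr_le0 rnorm_ge0.
Qed.

Lemma uniform_scaling (x : nat -> R) (k : nat) (e : R) : 0 < e ->
  exists s : R, 0 < s /\ forall m, (m < k)%N -> - e <= s * x m.
Proof.
move=> e0; elim: k => [|k [s [s0 IH]]]; first by exists 1.
have xk : 0 < 1 + `|x k| by rewrite ltr_wpDr.
pose s' := Num.min s (e / (1 + `|x k|)).
have s'0 : 0 < s' by rewrite lt_min s0 divr_gt0.
exists s'; split => // m.
rewrite lerNl -mulrN; have [x0 _|x0] := leP 0 (x m).
  by apply: le_trans (ltW e0); rewrite pmulr_rle0 // oppr_le0.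
rewrite ltnS leq_eqVlt => /predU1P[->|mk]; last first.
  rewrite mulrN lerNl; apply: le_trans (IH m mk) _.
  by rewrite ler_nM2r // ge_min lexx.
apply: (@le_trans _ _ (s' * (1 + `|x k|))).
  rewrite ler_pM2l //; apply: le_trans (ler_norm _) _.
  by rewrite normrN lerDr.
by rewrite -ler_pdivlMr // ge_min lexx orbT.
Qed.

(** The witness is the sum of the functions max (s_j v, (j + 1) F), where F is
    the peak function at z and the s_j are chosen small with respect to the
    values of v along a fixed sequence tending to z. *)
Lemma hull_boundary D A z : (0 < n)%N -> B_regular D -> b_pluripolar D A ->
  boundary D z -> b_pluripolar_hull D A z -> A z.
Proof.
move=> n0 Dreg [AD [v [pv v0 vfin vA]]] bz [_ hull]; apply: contrapT => nAz.
have [F [cF pF F0 FE]] := peak_function n0 Dreg bz.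
have [[oD cD _ _] _] := Dreg.
have clz : closure D z by case: bz.
have Fz : F z = 0 by rewrite FE // subrr rnorm0 oppr0.
have Fnear x (a : R) : closure D x -> F x < a ->
    \forall y \near within D (nbhs x), F y < a.
  move=> clx Fxa.
  have /(_ clx) := (subspace_continuousP _ _).1 cF x.
  move=> /cvgrPdist_lt/(_ (a - F x)); rewrite subr_gt0 => /(_ Fxa).
  rewrite !near_withinE; apply: filterS => y h Dy.
  have := h (subset_closure Dy); rewrite ltr_norml => /andP[+ _].
  by rewrite opprB /from_subspace => ?; lra.
have Fnearz (e : R) : 0 < e -> \forall y \near within D (nbhs z), - e <= F y.
  move=> e0; have /(_ clz) := (subspace_continuousP _ _).1 cF z.
  move=> /cvgrPdist_lt/(_ e e0); rewrite !near_withinE.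
  apply: filterS => y h Dy.
  have := h (subset_closure Dy); rewrite ltr_norml => /andP[_].
  by rewrite /from_subspace Fz => ?; lra.
(* the bound on F is such that (j + 1) F (w_m) >= - 2^-(j+2) for all j <= m *)
have w_ex (m : nat) : exists w, [/\ D w, rnorm (z - w) < m.+1%:R^-1,
    - (m.+1%:R * (2 ^ m.+2)%:R)^-1 <= F w & v w != -oo%E].
  have d0 : 0 < (m.+1%:R * (2 ^ m.+2)%:R)^-1 :> R.
    by rewrite invr_gt0 mulr_gt0 // ltr0n expn_gt0.
  have zm : nbhs z [set w | rnorm (z - w) < m.+1%:R^-1].
    by apply/nbhs_rnorm; exists m.+1%:R^-1.
  have := Fnearz _ d0; rewrite near_withinE => zF.
  have [w [Dw [] ? Fw ?]] :=
    psh_finite_dense oD cD pv v0 vfin clz (filterI zm zF).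
  by exists w; split => //; exact: Fw.
have /choice[w_ wP] := w_ex.
(* for m < j, where F (w_m) is not under control, the term s_j v takes over *)
have s_ex (j : nat) : exists s : R, 0 < s /\
    forall m, (m < j)%N -> - (1 / (2 ^ j.+2)%:R) <= s * fine (v (w_ m)).
  by apply: uniform_scaling; rewrite divr_gt0 // ltr0n expn_gt0.
have /choice[s_ sP] := s_ex.
pose u_ j (w : 'rV[R[i]]_n) :=
  maxe ((s_ j)%:E * v w)%E (j.+1%:R%:E * (F w)%:E)%E.
have F0e w : D w -> ((F w)%:E <= 0)%E by move=> Dw; rewrite lee_fin F0.
have [|||u [pu u0 uA uz]] := @psh_pluripolar_witness R n D A u_.
- by move=> j; apply: psh_max; apply: psh_scale => //; have [] := sP j.
- move=> j w Dw; rewrite ge_max; apply/andP; split.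
    by apply: mule_ge0_le0; [rewrite lee_fin ltW //; have [] := sP j|exact: v0].
  by rewrite -EFinM lee_fin mulr_ge0_le0 // F0.
- move=> x Ax; have bx := AD _ Ax.
  have xz : 0 < rnorm (x - z).
    by rewrite rnorm_gt0 subr_eq0; apply/eqP => xz; apply: nAz; rewrite -xz.
  exists (Num.bound (2 / rnorm (x - z))) => j Nj.
  have jx : 2 < j.+1%:R * rnorm (x - z).
    rewrite -ltr_pdivrMr //.
    apply: lt_le_trans (archi_boundP _) _; first by rewrite divr_ge0 // ltW.
    by rewrite ler_nat; exact: leq_trans Nj _.
  have Fx : F x < - (rnorm (x - z) / 2) by rewrite FE //; lra.
  have clx : closure D x by case: bx.
  have vx : (ustar D v x < ((s_ j)^-1 * -1)%:E)%E by rewrite vA // ltNyr.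
  apply: ustar_le; apply: filterS2 (Fnear _ _ clx Fx) (ustar_lt vx) => y Fy vy.
  rewrite ge_max; apply/andP; split.
    by have [? _] := sP j; rewrite -lee_pdivlMl // -EFinM ltW.
  rewrite -EFinM lee_fin.
  have : j.+1%:R * F y <= j.+1%:R * - (rnorm (x - z) / 2).
    by rewrite ler_pM2l // ltW.
  by move: jx => /=; lra.
have uw m : ((-1)%:E <= u (w_ m))%E.
  have [Dw _ Fw vw] := wP m; apply: uz => // j; rewrite le_max; apply/orP.
  have [mj|jm] := ltnP m j.
    left; have [_ /(_ _ mj)] := sP j; move: vw (v0 _ Dw).
    by case: (v (w_ m)) => [x| |] // _ _ h; rewrite -EFinM lee_fin.
  right; rewrite -EFinM lee_fin mul1r.
  have p2 k : 0 < (2 ^ k)%:R :> R by rewrite ltr0n expn_gt0.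
  apply: (@le_trans _ _ (j.+1%:R * - (m.+1%:R * (2 ^ m.+2)%:R)^-1)); last first.
    by rewrite ler_pM2l.
  rewrite mulrN lerN2 invfM mulrA.
  apply: (@le_trans _ _ (2 ^ m.+2)%:R^-1).
    apply: ler_piMl; first by rewrite invr_ge0 ltW.
    by rewrite ler_pdivrMr // mul1r ler_nat.
  by rewrite lef_pV2 ?posrE // ler_nat leq_exp2l.
have := ustar_ge (u := u) (D := D) (x := z) (a := (-1)%:E).
rewrite hull //; last first.
  have [Dw _ _ _] := wP 0; exists (w_ 0) => //.
  by apply/eqP => wE; have := uw 0; rewrite wE.
move=> h; suff : ((-1)%:E <= -oo :> \bar R)%E by [].
apply: h => U /nbhs_rnorm[e e0 eU].
pose m := Num.bound e^-1; have [Dw zw _ _] := wP m.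
exists (w_ m); split => //; apply: eU; apply: lt_trans zw _.
rewrite invf_plt ?posrE //.
apply: lt_le_trans (archi_boundP _) _; first by rewrite invr_ge0 ltW.
by rewrite ler_nat.
Qed.

End Hull.

Theorem theorem3p8 (R : realType) (n : nat) (hn : (0 < n)%N)
    (D A : set 'rV[R[i]]_n) (hD : B_regular D) (hA : b_pluripolar D A) :
  b_pluripolar_hull D A =
    A `|` [set z : 'rV[R[i]]_n | D z /\ (omega z A D < 0)%E].
Proof.
have [[oD _ _ _] _] := hD; have [AD _] := hA.
apply/seteqP; split => z.
- move=> hull; have [clz _] := hull; have [Dz|nDz] := pselect (D z).
    by right; split => //; exact: hull_omega_lt0.
  left; apply: hull_boundary hull => //.
  by split => // /interior_subset.
- case=> [Az|[Dz oz]]; last exact: omega_lt0_hull.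
  by split => [|u _ _ _ uA]; [have [] := AD _ Az|exact: uA].
Qed.
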